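(* Let $\overline{\ell}, \underline{v}, \overline{v}, v^{nom}$ be real numbers with $\overline{\ell}>0$ and $0<\underline{v}\le v^{nom}\le \overline{v}$, and let $\overline{S}=\sqrt{\overline{\ell}\,v^{nom}}$. Let $\Omega_0\subset\mathbb{R}^4$ be the set of all $x=(P,Q,\ell,v)\in\mathbb{R}^4$ satisfying $$v\,\ell=P^2+Q^2,\qquad 0\le \ell\le\overline{\ell},\qquad \underline{v}\le v\le\overline{v},\qquad P^2+Q^2\le\overline{S}^2 .$$ Then the convex hull of $\Omega_0$ is equal to the set $\Omega_2\subset\mathbb{R}^4$ of all $(P,Q,\ell,v)\in\mathbb{R}^4$ satisfying $$\big\|(\sqrt{2}\,P,\ \sqrt{2}\,Q,\ \ell,\ v)\big\|_2-(\ell+v)\le 0,$$ $$\overline{v}\,\ell+\overline{\ell}\,v-\overline{\ell}\,(\overline{v}+v^{nom})\le 0,$$ $$0\le \ell\le\overline{\ell},\qquad \underline{v}\le v\le\overline{v},\qquad P^2+Q^2\le\overline{S}^2 .$$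
   Context: For a fixed branch $ik$ of a power network, $P$ and $Q$ are the active and reactive power flow in the branch, $\ell$ is the squared current magnitude in the branch, $v$ is the squared voltage magnitude at bus $i$, and $v^{nom}$ is the nominal value of $v$. The numbers $\overline{\ell}$, $\underline{v}$, $\overline{v}$ are bounds, and $\overline{S}$ is the thermal limit of the line, related to the current limit by $\overline{S}=\sqrt{\overline{\ell}\,v^{nom}}$. $\|\cdot\|_2$ is the Euclidean norm on $\mathbb{R}^4$. *)

(* Defs.v *)
From mathcomp Require Import all_boot all_order all_algebra.
From mathcomp Require Import boolp classical_sets reals convex.

Set Implicit Arguments.
Unset Strict Implicit.
Unset Printing Implicit Defensive.

Import Order.TTheory GRing.Theory Num.Theory.
Local Open Scope classical_set_scope.
Local Open Scope ring_scope.

(* The intersection of all convex sets containing A. *)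
Definition convex_hull (R : numDomainType) (M : lmodType R) (A : set M) :
  set M := smallest (@convex_set R M) A.

(* The norm `|x| of the library on row vectors is the sup norm. *)
Definition norm2 (R : rcfType) (n : nat) (x : 'rV[R]_n) : R :=
  Num.sqrt (\sum_(i < n) x 0 i ^+ 2).

Definition row4 (R : nzRingType) (a b c d : R) : 'rV[R]_4 :=
  \row_(i < 4) [:: a; b; c; d]`_i.

(* A point (P, Q, l, v) of R^4 is the row vector x with P = x 0 0, Q = x 0 1,
   l = x 0 2 and v = x 0 3; lbar, vlow, vbar, Sbar are the bounds on the squared
   current, the squared voltage and the apparent power. *)
Definition Omega0 (R : realType) (lbar vlow vbar Sbar : R) : set 'rV[R]_4 :=
  [set x | let P := x 0 0 in let Q := x 0 1 in
           let l := x 0 2 in let v := x 0 3 in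
    [/\ v * l = P ^+ 2 + Q ^+ 2,
        0 <= l <= lbar,
        vlow <= v <= vbar &
        P ^+ 2 + Q ^+ 2 <= Sbar ^+ 2]].

Definition Omega2 (R : realType) (lbar vlow vbar vnom Sbar : R) :
    set 'rV[R]_4 :=
  [set x | let P := x 0 0 in let Q := x 0 1 in
           let l := x 0 2 in let v := x 0 3 in
    [/\ norm2 (row4 (Num.sqrt 2 * P) (Num.sqrt 2 * Q) l v) - (l + v) <= 0,
        vbar * l + lbar * v - lbar * (vbar + vnom) <= 0,
        0 <= l <= lbar,
        vlow <= v <= vbar &
        P ^+ 2 + Q ^+ 2 <= Sbar ^+ 2]].

(* Main.v *)
Require Import Defs.
From mathcomp Require Import all_boot all_order all_algebra.
From mathcomp Require Import boolp classical_sets reals convex.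
From mathcomp Require Import interval_inference ring lra.

(** The norm inequality says that 2 (P^2 + Q^2) <= 2 l v, that is, that
    (P, Q, l, v) lies in the rotated second-order cone P^2 + Q^2 <= l v.  This
    cone is convex, the disc P^2 + Q^2 <= Sbar^2 is its section l = v = Sbar,
    and the other constraints are affine, so Omega2 is convex
    ([convex_Omega2]).  It contains Omega0: the only new constraint, the cut,
    follows from v l <= lbar vnom and (lbar - l) (vbar - v) >= 0
    ([Omega0_sub_Omega2]).

    Conversely, let C be a convex set that contains Omega0, and take a point
    of Omega2.  If v l <= Sbar^2, moving P in both directions until
    P^2 + Q^2 = v l reaches two points of Omega0 with the given point between
    them ([cone_section_sub_hull]).  Otherwise (l, v) lies strictly beyond the
    hyperbola v l = Sbar^2 = lbar vnom, on the near side of the line where the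
    cut is an equality.  This line is the chord of the hyperbola through
    (lbar, vnom) and (lbar vnom / vbar, vbar).  With P and Q fixed, the points
    over the hyperbola belong to C by the first case
    ([hyperbola_sub_hull]), hence so do those over the chord
    ([chord_sub_hull]), and (l, v) lies between a point of the hyperbola and
    a point of the chord with the same v ([Omega2_sub_hull]). *)

Import Order.TTheory GRing.Theory Num.Theory.
Local Open Scope classical_set_scope.
Local Open Scope ring_scope.

Lemma convex_setP {R : numDomainType} {M : lmodType R} (C : set M) :
  convex_set C <->
  forall (t : R) (x y : M), 0 <= t <= 1 -> C x -> C y ->
    C (t *: x + (1 - t) *: y).
Proof.
split=> [cC t x y /andP[t0 t1] Cx Cy | cC x y t].
  by have := cC x y (Itv01 t0 t1); rewrite !inE; apply.
by rewrite !inE => Cx Cy; apply: cC => //; apply/andP; split.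
Qed.

(** Being able to give the parameters of the three points on a line, instead
    of barycentric weights, is what makes the moves in a single coordinate
    below direct. *)
Lemma convex_set_line {R : numFieldType} {M : lmodType R} {C : set M}
    (a d : M) (r s t : R) :
  convex_set C -> C (a + r *: d) -> C (a + t *: d) -> r <= s <= t ->
  C (a + s *: d).
Proof.
move=> /convex_setP cC Cr Ct /andP[rs st].
have [rt|rt] := eqVneq r t.
  by have -> : s = r by apply/le_anti; rewrite rs {1}rt st.
have rt_gt0 : 0 < t - r by rewrite subr_gt0 lt_neqAle rt (le_trans rs st).
have := cC ((s - r) / (t - r)) _ _ _ Ct Cr.
set k := (s - r) / (t - r).
have -> : k *: (a + t *: d) + (1 - k) *: (a + r *: d) = a + s *: d.
  have -> : s = k * t + (1 - k) * r.
    by rewrite /k; field; rewrite gt_eqF.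
  rewrite !scalerDr !scalerA addrACA -scalerDl -scalerDl.
  by rewrite (addrC k) subrK scale1r.
apply; apply/andP; split; first by rewrite divr_ge0 ?subr_ge0 ?(le_trans rs st).
by rewrite ler_pdivrMr // mul1r lerD2r.
Qed.

Lemma row4_eta {R : nzRingType} (x : 'rV[R]_4) :
  x = row4 (x 0 0) (x 0 1) (x 0 2) (x 0 3).
Proof.
apply/rowP => i; rewrite mxE.
by case: i => [[|[|[|[|]]]] //= Hi]; congr (x _ _); apply/val_inj.
Qed.

Lemma row4D {R : nzRingType} (a b c d a' b' c' d' : R) :
  row4 a b c d + row4 a' b' c' d' = row4 (a + a') (b + b') (c + c') (d + d').
Proof. by apply/rowP; case=> [[|[|[|[|]]]] //= Hi]; rewrite !mxE. Qed.

Lemma row4Z {R : nzRingType} (k a b c d : R) :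
  k *: row4 a b c d = row4 (k * a) (k * b) (k * c) (k * d).
Proof. by apply/rowP; case=> [[|[|[|[|]]]] //= Hi]; rewrite !mxE. Qed.

Lemma Omega0_row4 {R : realType} (lbar vlow vbar Sbar P Q l v : R) :
  Omega0 lbar vlow vbar Sbar (row4 P Q l v) <->
  [/\ v * l = P ^+ 2 + Q ^+ 2, 0 <= l <= lbar, vlow <= v <= vbar &
      P ^+ 2 + Q ^+ 2 <= Sbar ^+ 2].
Proof. by rewrite /Omega0 /= !mxE. Qed.

(** Squaring the norm gives 2 P^2 + 2 Q^2 + l^2 + v^2 <= (l + v)^2, where
    l^2 + v^2 cancels. *)
Lemma norm2_cone {R : rcfType} (P Q l v : R) : 0 <= l -> 0 <= v ->
  (norm2 (row4 (Num.sqrt 2 * P) (Num.sqrt 2 * Q) l v) - (l + v) <= 0) =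
  (P ^+ 2 + Q ^+ 2 <= l * v).
Proof.
move=> l0 v0.
rewrite subr_le0 /norm2 !big_ord_recr big_ord0 /= !mxE /= add0r.
rewrite !exprMn sqr_sqrtr ?ler0n //.
rewrite -[X in _ <= X]ger0_norm ?addr_ge0 // -sqrtr_sqr ler_sqrt ?sqr_ge0 //.
by apply/idP/idP; nra.
Qed.

Lemma Omega2_row4 {R : realType} (lbar vlow vbar vnom Sbar P Q l v : R) :
  0 < vlow ->
  Omega2 lbar vlow vbar vnom Sbar (row4 P Q l v) <->
  [/\ P ^+ 2 + Q ^+ 2 <= l * v, vbar * l + lbar * v <= lbar * (vbar + vnom),
      0 <= l <= lbar, vlow <= v <= vbar & P ^+ 2 + Q ^+ 2 <= Sbar ^+ 2].
Proof.
move=> vlow0; rewrite /Omega2 /= !mxE /= [vbar * _ + _ - _ <= 0]subr_le0.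
by split=> -[h1 h2 /andP[l0 lb] /andP[vl vb] h5];
  move: h1; rewrite norm2_cone ?(le_trans (ltW vlow0) vl) // => h1;
  split=> //; apply/andP.
Qed.

(** The cross term satisfies P P' + Q Q' <= sqrt (l v) sqrt (l' v') by
    Cauchy-Schwarz, and the right-hand side is the geometric mean of l v' and
    l' v, at most (l v' + l' v) / 2. *)
Lemma rsoc_add {R : realDomainType} (P Q l v P' Q' l' v' : R) :
  0 <= l -> 0 <= v -> 0 <= l' -> 0 <= v' ->
  P ^+ 2 + Q ^+ 2 <= l * v -> P' ^+ 2 + Q' ^+ 2 <= l' * v' ->
  (P + P') ^+ 2 + (Q + Q') ^+ 2 <= (l + l') * (v + v').
Proof.
move=> l0 v0 l0' v0' h h'.
have w0 : 0 <= l * v' + l' * v by rewrite addr_ge0 ?mulr_ge0.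
suff : 2 * (P * P' + Q * Q') <= l * v' + l' * v by nra.
apply: le_trans (ler_norm _) _; rewrite -[X in _ <= X]ger0_norm //.
rewrite -ler_sqr ?nnegrE // !real_normK ?num_real //.
have hh := ler_pM (addr_ge0 (sqr_ge0 P) (sqr_ge0 Q))
  (addr_ge0 (sqr_ge0 P') (sqr_ge0 Q')) h h'.
(* Lagrange's identity, then the inequality of the two means. *)
have := sqr_ge0 (P * Q' - Q * P').
have := sqr_ge0 (l * v' - l' * v).
nra.
Qed.

Lemma rsoc_conv {R : realDomainType} (t P Q l v P' Q' l' v' : R) :
  0 <= t <= 1 -> 0 <= l -> 0 <= v -> 0 <= l' -> 0 <= v' ->
  P ^+ 2 + Q ^+ 2 <= l * v -> P' ^+ 2 + Q' ^+ 2 <= l' * v' ->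
  (t * P + (1 - t) * P') ^+ 2 + (t * Q + (1 - t) * Q') ^+ 2 <=
  (t * l + (1 - t) * l') * (t * v + (1 - t) * v').
Proof.
move=> /andP[t0 t1] l0 v0 l0' v0' h h'.
have t1' : 0 <= 1 - t by rewrite subr_ge0.
have scaled (k a b c d : R) : a ^+ 2 + b ^+ 2 <= c * d ->
    (k * a) ^+ 2 + (k * b) ^+ 2 <= k * c * (k * d).
  by move=> hk; rewrite !exprMn -mulrDr mulrACA -expr2 ler_wpM2l ?sqr_ge0.
by apply: rsoc_add; rewrite ?mulr_ge0 //; apply: scaled.
Qed.

Lemma convex_Omega2 {R : realType} (lbar vlow vbar vnom Sbar : R) :
  0 < vlow -> 0 <= Sbar -> convex_set (Omega2 lbar vlow vbar vnom Sbar).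
Proof.
move=> vlow0 S0; apply/convex_setP => t x y t01.
rewrite (row4_eta x) (row4_eta y) !row4Z row4D !Omega2_row4 //.
move: (x 0 0) (x 0 1) (x 0 2) (x 0 3) => P Q l v.
move: (y 0 0) (y 0 1) (y 0 2) (y 0 3) => P' Q' l' v'.
move=> [h1 h2 /andP[l0 lb] /andP[vl vb] h5].
move=> [h1' h2' /andP[l0' lb'] /andP[vl' vb'] h5'].
(* The disc is the section of the cone by l = v = Sbar. *)
have disc := rsoc_conv t P Q Sbar Sbar P' Q' Sbar Sbar t01 S0 S0 S0 S0 h5 h5'.
have tS : t * Sbar + (1 - t) * Sbar = Sbar by ring.
have cone : (t * P + (1 - t) * P') ^+ 2 + (t * Q + (1 - t) * Q') ^+ 2 <=
    (t * l + (1 - t) * l') * (t * v + (1 - t) * v').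
  by apply: rsoc_conv => //; lra.
move: t01 => /andP[t0 t1].
split=> //; first by nra.
- by apply/andP; split; nra.
- by apply/andP; split; nra.
- by move: disc; rewrite tS expr2.
Qed.

Lemma Omega0_sub_Omega2 {R : realType} (lbar vlow vbar vnom Sbar : R) :
  0 < vlow -> Sbar ^+ 2 = lbar * vnom ->
  Omega0 lbar vlow vbar Sbar `<=` Omega2 lbar vlow vbar vnom Sbar.
Proof.
move=> vlow0 S2 x; rewrite (row4_eta x) Omega0_row4 Omega2_row4 //.
move=> [vl h2 h3 h4]; split=> //; first by rewrite -vl mulrC.
move: h2 h3 => /andP[_ llbar] /andP[_ vvbar].
rewrite S2 -vl in h4; nra.
Qed.

(** The point lies on the segment between the two points (p, Q, l, v) and
    (- p, Q, l, v) with p^2 + Q^2 = v l, which belong to Omega0. *)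
Lemma cone_section_sub_hull {R : realType} {lbar vlow vbar Sbar : R}
    {C : set 'rV[R]_4} (P Q l v : R) :
  convex_set C -> Omega0 lbar vlow vbar Sbar `<=` C ->
  0 <= l <= lbar -> vlow <= v <= vbar -> v * l <= Sbar ^+ 2 ->
  P ^+ 2 + Q ^+ 2 <= v * l -> C (row4 P Q l v).
Proof.
move=> cC subC hl hv vlS PQ.
set p := Num.sqrt (v * l - Q ^+ 2).
have p2 : p ^+ 2 = v * l - Q ^+ 2.
  by rewrite sqr_sqrtr // subr_ge0 (le_trans _ PQ) // lerDr sqr_ge0.
have line q : row4 0 Q l v + q *: row4 1 0 0 0 = row4 q Q l v.
  by rewrite row4Z row4D add0r mulr1 !mulr0 !addr0.
have onP q : q ^+ 2 = p ^+ 2 -> C (row4 q Q l v).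
  by move=> qp; apply: subC; apply/Omega0_row4; rewrite qp p2 subrK.
rewrite -line; apply: (convex_set_line _ _ (- p) _ p) => //; rewrite ?line.
- by apply: onP; rewrite sqrrN.
- exact: onP.
- rewrite -ler_norml -ler_sqr ?nnegrE ?sqrtr_ge0 // real_normK ?num_real //.
  by rewrite p2 lerBrDr.
Qed.

(** On the hyperbola v l = lbar vnom the cone and the disc constraints on
    (P, Q) coincide; vnom <= v keeps l below lbar. *)
Lemma hyperbola_sub_hull {R : realType} {lbar vlow vbar vnom Sbar : R}
    {C : set 'rV[R]_4} (P Q v : R) :
  convex_set C -> Omega0 lbar vlow vbar Sbar `<=` C ->
  0 < lbar -> 0 < vlow -> vlow <= vnom -> Sbar ^+ 2 = lbar * vnom ->
  vnom <= v <= vbar ->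
  P ^+ 2 + Q ^+ 2 <= Sbar ^+ 2 -> C (row4 P Q (lbar * vnom / v) v).
Proof.
move=> cC subC lbar0 vlow0 vlown S2 /andP[nv vb] PQ.
have v0 : 0 < v by lra.
have vE : v * (lbar * vnom / v) = lbar * vnom by field; rewrite gt_eqF.
apply: (cone_section_sub_hull _ _ _ _ cC subC).
- apply/andP; split; first by rewrite divr_ge0 ?mulr_ge0 //; lra.
  by rewrite ler_pdivrMr // ler_pM2l.
- by apply/andP; split; lra.
- by rewrite vE S2.
- by rewrite vE -S2.
Qed.

(** The chord v |-> (lbar (vbar + vnom - v) / vbar, v), along which the cut is
    an equality, meets the hyperbola at v = vnom and at v = vbar. *)
Lemma chord_sub_hull {R : realType} {lbar vlow vbar vnom Sbar : R}
    {C : set 'rV[R]_4} (P Q v : R) :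
  convex_set C -> Omega0 lbar vlow vbar Sbar `<=` C ->
  0 < lbar -> 0 < vlow -> vlow <= vnom -> Sbar ^+ 2 = lbar * vnom ->
  vnom <= v <= vbar ->
  P ^+ 2 + Q ^+ 2 <= Sbar ^+ 2 ->
  C (row4 P Q (lbar * (vbar + vnom - v) / vbar) v).
Proof.
move=> cC subC lbar0 vlow0 vlown S2 hv PQ.
have [nv vb] := andP hv.
have vbar0 : 0 < vbar by lra.
have nvbar : vnom <= vbar by lra.
have onchord u :
    row4 P Q (lbar * (vbar + vnom) / vbar) 0 + u *: row4 0 0 (- lbar / vbar) 1 =
    row4 P Q (lbar * (vbar + vnom - u) / vbar) u.
  rewrite row4Z row4D !mulr0 !addr0 mulr1 add0r; congr row4.
  by field; rewrite gt_eqF.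
rewrite -onchord; apply: convex_set_line hv => //; rewrite onchord.
- have -> : lbar * (vbar + vnom - vnom) / vbar = lbar * vnom / vnom.
    by field; rewrite !gt_eqF //; lra.
  by apply: (hyperbola_sub_hull _ _ _ cC subC); rewrite ?lexx.
- have -> : vbar + vnom - vbar = vnom by ring.
  by apply: (hyperbola_sub_hull _ _ _ cC subC); rewrite ?lexx ?andbT.
Qed.

Lemma Omega2_sub_hull {R : realType} {lbar vlow vbar vnom Sbar : R}
    {C : set 'rV[R]_4} :
  convex_set C -> Omega0 lbar vlow vbar Sbar `<=` C ->
  0 < lbar -> 0 < vlow -> vlow <= vnom -> Sbar ^+ 2 = lbar * vnom ->
  Omega2 lbar vlow vbar vnom Sbar `<=` C.
Proof.
move=> cC subC lbar_gt0 vlow_gt0 vlow_le_vnom S2 x.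
rewrite (row4_eta x) Omega2_row4 //.
move: (x 0 0) (x 0 1) (x 0 2) (x 0 3) => P Q l v [PQlv cut hl hv PQS].
have [vlS|Svl] := leP (v * l) (Sbar ^+ 2).
  by apply: (cone_section_sub_hull _ _ _ _ cC subC); rewrite // mulrC.
have /andP[l0 llbar] := hl; have /andP[vlv vvbar] := hv.
have v0 : 0 < v by lra.
(* Beyond the hyperbola, l <= lbar forces v to exceed vnom. *)
have vnomv : vnom <= v.
  rewrite S2 in Svl; rewrite -(ler_pM2l lbar_gt0) (le_trans (ltW Svl)) //.
  by rewrite mulrC ler_pM2r.
have horizontal k :
    row4 P Q 0 v + k *: row4 0 0 1 0 = row4 P Q k v.
  by rewrite row4Z row4D !mulr0 !addr0 mulr1 add0r.
rewrite -horizontal.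
apply: (convex_set_line _ _ (lbar * vnom / v) _
  (lbar * (vbar + vnom - v) / vbar)) => //; rewrite ?horizontal.
- by apply: (hyperbola_sub_hull _ _ _ cC subC) => //; apply/andP.
- by apply: (chord_sub_hull _ _ _ cC subC) => //; apply/andP.
- apply/andP; split; first by rewrite ler_pdivrMr // -S2 mulrC ltW.
  rewrite ler_pdivlMr; last by lra.
  by rewrite mulrC; lra.
Qed.

Theorem mainTheorem1 (R : realType) (lbar vlow vbar vnom Sbar : R)
    (lbar_gt0 : 0 < lbar) (vlow_gt0 : 0 < vlow)
    (vlow_le_vnom : vlow <= vnom) (vnom_le_vbar : vnom <= vbar)
    (SbarE : Sbar = Num.sqrt (lbar * vnom)) :
  convex_hull (Omega0 lbar vlow vbar Sbar) = Omega2 lbar vlow vbar vnom Sbar.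
Proof.
have S0 : 0 <= Sbar by rewrite SbarE sqrtr_ge0.
have S2 : Sbar ^+ 2 = lbar * vnom.
  by rewrite SbarE sqr_sqrtr // mulr_ge0; lra.
apply/seteqP; split.
  by apply: smallest_sub; [exact: convex_Omega2 | exact: Omega0_sub_Omega2].
move=> x Ox C [cC subC].
exact: Omega2_sub_hull cC subC lbar_gt0 vlow_gt0 vlow_le_vnom S2 _ Ox.
Qed.
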